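(* Let $c = c_0 + c_1\mathbf{i} + c_2\mathbf{j} + c_3\mathbf{k} \in \mathbb{S}\setminus\mathbb{R}$. The polynomial $P = t^2 + c \in \mathbb{S}[t]$ admits a factorization if and only if at least one of the following two conditions holds: (i) $\operatorname{Im}(c)\,\operatorname{Im}(c)^\ast > 0$; (ii) $c c^\ast \ge 0$ and $c_0 < 0$.
   Context: The algebra $\mathbb{S}$ of split quaternions is the four-dimensional real associative unital algebra with basis $1,\mathbf{i},\mathbf{j},\mathbf{k}$ and multiplication determined by $\mathbf{i}^2=-1$, $\mathbf{j}^2=\mathbf{k}^2=1$, $\mathbf{i}\mathbf{j}\mathbf{k}=1$ (so $\mathbf{i},\mathbf{j},\mathbf{k}$ pairwise anti-commute and $\mathbf{i}\mathbf{j}=\mathbf{k}$). $\mathbb{R}$ is identified with $\mathbb{R}\cdot 1\subset\mathbb{S}$. For $h=h_0+h_1\mathbf{i}+h_2\mathbf{j}+h_3\mathbf{k}$ (with $h_\ell\in\mathbb{R}$), the conjugate is $h^\ast=h_0-h_1\mathbf{i}-h_2\mathbf{j}-h_3\mathbf{k}$, the norm is $hh^\ast=h^\ast h=h_0^2+h_1^2-h_2^2-h_3^2\in\mathbb{R}$, and the imaginary (vector) part is $\operatorname{Im}(h)=h_1\mathbf{i}+h_2\mathbf{j}+h_3\mathbf{k}$. $\mathbb{S}[t]$ is the ring of polynomials in one indeterminate $t$ over $\mathbb{S}$, where $t$ commutes with all coefficients. A monic quadratic polynomial $P\in\mathbb{S}[t]$ admits a factorization if there exist $h_1,h_2\in\mathbb{S}$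 with $P=(t-h_1)(t-h_2)$. *)

(* Defs.v *)
From HB Require Import structures.
From mathcomp Require Import all_boot all_order all_algebra.
From mathcomp Require Import reals.
From mathcomp Require Import ring.

Set Implicit Arguments.
Unset Strict Implicit.
Unset Printing Implicit Defensive.

Import GRing.Theory.
Local Open Scope ring_scope.

(* SplitQuat h0 h1 h2 h3 stands for h0 + h1 i + h2 j + h3 k. *)
Record split_quat (R : Type) : Type :=
  SplitQuat { sq0 : R; sq1 : R; sq2 : R; sq3 : R }.

Section Choice.
Variable R : Type.

Definition tuple_of_sq (h : split_quat R) : R * R * R * R :=
  (sq0 h, sq1 h, sq2 h, sq3 h).

Definition sq_of_tuple (x : R * R * R * R) : split_quat R :=
  let: (a, b, c, d) := x in SplitQuat a b c d.

Lemma tuple_of_sqK : cancel tuple_of_sq sq_of_tuple.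
Proof. by case. Qed.

End Choice.

HB.instance Definition _ (R : eqType) :=
  Equality.copy (split_quat R) (can_type (@tuple_of_sqK R)).
HB.instance Definition _ (R : choiceType) :=
  Choice.copy (split_quat R) (can_type (@tuple_of_sqK R)).

Section Algebra.
Variable R : comNzRingType.
Implicit Types (g h : split_quat R) (a : R).

Definition sq_zero : split_quat R := SplitQuat 0 0 0 0.

Definition sq_add g h : split_quat R :=
  SplitQuat (sq0 g + sq0 h) (sq1 g + sq1 h) (sq2 g + sq2 h) (sq3 g + sq3 h).

Definition sq_opp h : split_quat R :=
  SplitQuat (- sq0 h) (- sq1 h) (- sq2 h) (- sq3 h).

Definition sq_one : split_quat R := SplitQuat 1 0 0 0.

(* Bilinear extension of i^2 = -1, j^2 = k^2 = 1, ij = k = - ji,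
   jk = - i = - kj, ki = j = - ik; see sq_ii .. sq_ijk below. *)
Definition sq_mul g h : split_quat R :=
  SplitQuat
    (sq0 g * sq0 h - sq1 g * sq1 h + sq2 g * sq2 h + sq3 g * sq3 h)
    (sq0 g * sq1 h + sq1 g * sq0 h - sq2 g * sq3 h + sq3 g * sq2 h)
    (sq0 g * sq2 h + sq2 g * sq0 h - sq1 g * sq3 h + sq3 g * sq1 h)
    (sq0 g * sq3 h + sq3 g * sq0 h + sq1 g * sq2 h - sq2 g * sq1 h).

Definition sq_scale a h : split_quat R :=
  SplitQuat (a * sq0 h) (a * sq1 h) (a * sq2 h) (a * sq3 h).

Local Ltac sq_ring :=
  repeat (let h := fresh in intro h; try destruct h);
  rewrite /sq_add /sq_opp /sq_mul /sq_scale /sq_zero /sq_one /=;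
  congr SplitQuat; ring.

Lemma sq_addA : associative sq_add. Proof. sq_ring. Qed.
Lemma sq_addC : commutative sq_add. Proof. sq_ring. Qed.
Lemma sq_add0 : left_id sq_zero sq_add. Proof. sq_ring. Qed.
Lemma sq_addN : left_inverse sq_zero sq_opp sq_add. Proof. sq_ring. Qed.

HB.instance Definition _ :=
  GRing.isZmodule.Build (split_quat R) sq_addA sq_addC sq_add0 sq_addN.

Lemma sq_mulA : associative sq_mul. Proof. sq_ring. Qed.
Lemma sq_mul1l : left_id sq_one sq_mul. Proof. sq_ring. Qed.
Lemma sq_mul1r : right_id sq_one sq_mul. Proof. sq_ring. Qed.
Lemma sq_mulDl : left_distributive sq_mul sq_add. Proof. sq_ring. Qed.
Lemma sq_mulDr : right_distributive sq_mul sq_add. Proof. sq_ring. Qed.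
Lemma sq_one_neq0 : sq_one != 0 :> split_quat R.
Proof. by apply/eqP => -[/eqP]; rewrite oner_eq0. Qed.

HB.instance Definition _ :=
  GRing.Zmodule_isNzRing.Build (split_quat R)
    sq_mulA sq_mul1l sq_mul1r sq_mulDl sq_mulDr sq_one_neq0.

Lemma sq_scaleA a b h : sq_scale a (sq_scale b h) = sq_scale (a * b) h.
Proof. sq_ring. Qed.
Lemma sq_scale1 : left_id 1 sq_scale. Proof. sq_ring. Qed.
Lemma sq_scaleDr : right_distributive sq_scale sq_add. Proof. sq_ring. Qed.
Lemma sq_scaleDl h :
  {morph sq_scale^~ h : a b / a + b >-> sq_add a b}.
Proof. sq_ring. Qed.

HB.instance Definition _ :=
  GRing.Zmodule_isLmodule.Build R (split_quat R)
    sq_scaleA sq_scale1 sq_scaleDr sq_scaleDl.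

Lemma sq_scaleAl a g h : sq_scale a (sq_mul g h) = sq_mul (sq_scale a g) h.
Proof. sq_ring. Qed.
HB.instance Definition _ :=
  GRing.Lmodule_isLalgebra.Build R (split_quat R) sq_scaleAl.

Lemma sq_scaleAr a g h : sq_scale a (sq_mul g h) = sq_mul g (sq_scale a h).
Proof. sq_ring. Qed.
HB.instance Definition _ :=
  GRing.Lalgebra_isAlgebra.Build R (split_quat R) sq_scaleAr.

Definition sq_i : split_quat R := SplitQuat 0 1 0 0.
Definition sq_j : split_quat R := SplitQuat 0 0 1 0.
Definition sq_k : split_quat R := SplitQuat 0 0 0 1.

Definition sq_conj h : split_quat R :=
  SplitQuat (sq0 h) (- sq1 h) (- sq2 h) (- sq3 h).

Definition sq_Im h : split_quat R := SplitQuat 0 (sq1 h) (sq2 h) (sq3 h).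

(* h h^* is a scalar of the algebra (sq_mul_conj); sq_norm h is that scalar
   as an element of R. *)
Definition sq_norm h : R := sq0 (h * sq_conj h).

Definition sq_is_real h : Prop := exists a : R, h = a%:A.

Definition admits_factorization (P : {poly split_quat R}) : Prop :=
  exists h1 h2 : split_quat R, P = ('X - h1%:P) * ('X - h2%:P).

Local Ltac sq_eq := congr SplitQuat => /=; ring.

Lemma sq_ii : sq_i * sq_i = - 1. Proof. sq_eq. Qed.
Lemma sq_jj : sq_j * sq_j = 1. Proof. sq_eq. Qed.
Lemma sq_kk : sq_k * sq_k = 1. Proof. sq_eq. Qed.
Lemma sq_ij : sq_i * sq_j = sq_k. Proof. sq_eq. Qed.
Lemma sq_ijk : sq_i * sq_j * sq_k = 1. Proof. sq_eq. Qed.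

Lemma sq_basis h :
  h = (sq0 h)%:A + sq1 h *: sq_i + sq2 h *: sq_j + sq3 h *: sq_k.
Proof. by case: h => a b c d; sq_eq. Qed.

Lemma sq_normE h :
  sq_norm h = sq0 h ^+ 2 + sq1 h ^+ 2 - sq2 h ^+ 2 - sq3 h ^+ 2.
Proof. by rewrite /sq_norm /=; ring. Qed.

Lemma sq_mul_conj h : h * sq_conj h = (sq_norm h)%:A.
Proof. by rewrite /sq_norm; case: h => a b c d; sq_eq. Qed.

Lemma sq_conj_mul h : sq_conj h * h = (sq_norm h)%:A.
Proof. by rewrite /sq_norm; case: h => a b c d; sq_eq. Qed.

End Algebra.

(* Main.v *)
Require Import Defs.
From HB Require Import structures.
From mathcomp Require Import all_boot all_order all_algebra.
From mathcomp Require Import reals.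
From mathcomp Require Import ring lra.

(** Comparing coefficients in [t^2 + c = (t - h1) (t - h2)] gives [h2 = - h1],
    so [t^2 + c] factors iff [- c] is a square.  If [- c = (a + v)^2] with [a]
    real and [v] imaginary, then [Im c = - 2 a v]; as [c] is not real,
    [a <> 0], and [x = 2 a^2] is a positive root of
    [x^2 + 2 c0 x = N], where [N] is the norm of [Im c].  Conversely such a
    root determines [a] and [v].  Completing the square turns this equation
    into [(x + c0)^2 = c c^*], which has a positive root exactly under
    (i) or (ii). *)

Import Order.TTheory GRing.Theory Num.Theory.
Local Open Scope ring_scope.

Lemma mul_XsubC (S : nzRingType) (g h : S) :
  ('X - g%:P) * ('X - h%:P) = 'X^2 - (g + h)%:P * 'X + (g * h)%:P.
Proof.
rewrite mulrBl !mulrBr -(commr_polyX h%:P) -expr2 polyCD polyCM mulrDl.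
by rewrite opprB !opprD !addrA [LHS]addrAC; congr (_ + _); rewrite addrAC.
Qed.

Lemma X2addC_factorP (S : nzRingType) (c : S) :
  (exists g h, 'X^2 + c%:P = ('X - g%:P) * ('X - h%:P)) <->
  exists h, c = - (h * h).
Proof.
split=> [[g [h]]|[h ->]]; last first.
  by exists h, (- h); rewrite mul_XsubC subrr mul0r subr0 mulrN.
rewrite mul_XsubC => eqP2.
have := congr1 (coefp 0) eqP2; have := congr1 (coefp 1) eqP2.
rewrite /= !(coefD, coefN, coefMX, coefXn, coefC, coefCM, coefX) /= ?(add0r, addr0, oppr0).
move=> /esym/eqP; rewrite oppr_eq0 addrC addr_eq0 => /eqP ->.
by move=> ->; exists g; rewrite mulrN.
Qed.

Lemma opp_sqr_split_quatP (R : rcfType) (c : split_quat R) :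
  ~ sq_is_real c ->
  (exists h, c = - (h * h)) <->
  exists2 x : R, 0 < x & x ^+ 2 + 2 * sq0 c * x = sq_norm (sq_Im c).
Proof.
case: c => c0 c1 c2 c3 cNreal; rewrite sq_normE /=; split.
  case=> -[a v1 v2 v3] [e0 e1 e2 e3].
  (* The square of a purely imaginary element is real. *)
  have a_neq0 : a != 0.
    apply/eqP => a0; apply: cNreal; exists c0.
    by rewrite e1 e2 e3 a0; congr SplitQuat => /=; ring.
  exists (2 * a ^+ 2); first by rewrite mulr_gt0 // exprn_even_gt0.
  by rewrite e0 e1 e2 e3; ring.
case=> x x_gt0 xE.
have a_gt0 : 0 < Num.sqrt (x / 2) by rewrite sqrtr_gt0 divr_gt0.
have := sqr_sqrtr (ltW (divr_gt0 x_gt0 (ltr0n R 2))).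
move: (Num.sqrt _) a_gt0 => a a_gt0 a2E; have a_neq0 := lt0r_neq0 a_gt0.
(* The imaginary part is [Im c = - 2 a v] solved for [v]. *)
exists (SplitQuat a (- c1 / (2 * a)) (- c2 / (2 * a)) (- c3 / (2 * a))).
have {a2E}xaE : x = 2 * a ^+ 2 by rewrite a2E; field.
congr SplitQuat => /=; try by field.
(* Only the real part is left; scaling it by [4 a^2 = 2 x] clears denominators and yields the
   equation for [x]. *)
apply: (@mulfI _ (4 * a ^+ 2)); first by rewrite mulf_neq0 ?expf_neq0 ?pnatr_eq0.
transitivity (2 * c0 * x); first by rewrite xaE; ring.
by rewrite -[LHS](addKr (x ^+ 2)) xE xaE; field.
Qed.

Lemma pos_root_quadP (R : rcfType) (b N : R) :
  (exists2 x : R, 0 < x & x ^+ 2 + 2 * b * x = N) <->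
  0 < N \/ (0 <= b ^+ 2 + N /\ b < 0).
Proof.
split=> [[x x_gt0 xE]|bN].
  have [N_gt0|N_le0] := ltP 0 N; [by left | right].
  (* If [N <= 0], then [x (x + 2 b) <= 0] with [x > 0], so [2 b <= - x < 0]. *)
  split; last by nra.
  by have := sqr_ge0 (x + b); rewrite -xE; lra.
have D_ge0 : 0 <= b ^+ 2 + N by have := sqr_ge0 b; case: bN => [|[]]; lra.
have := sqr_sqrtr D_ge0; have := sqrtr_ge0 (b ^+ 2 + N).
move: (Num.sqrt _) => s s_ge0 sE.
(* The larger root of [(x + b)^2 = b^2 + N]. *)
exists (s - b).
  case: bN => [N_gt0|[_ b_lt0]]; last by lra.
  (* [0 <= s <= b] would give [b^2 + N = s^2 <= b^2], against [N > 0]. *)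
  by rewrite ltNge; apply/negP => le_sb; have := mulr_ge0 s_ge0 s_ge0; nra.
have -> : N = s ^+ 2 - b ^+ 2 by rewrite sE; ring.
ring.
Qed.

Theorem theorem3p5 (R : realType) (c : split_quat R) (hc : ~ sq_is_real c) :
  admits_factorization ('X^2 + c%:P) <->
  0 < sq_norm (sq_Im c) \/ (0 <= sq_norm c /\ sq0 c < 0).
Proof.
have -> : sq_norm c = sq0 c ^+ 2 + sq_norm (sq_Im c).
  by rewrite !sq_normE /=; ring.
apply: iff_trans (X2addC_factorP _ c) _.
exact: iff_trans (opp_sqr_split_quatP _ _ hc) (pos_root_quadP _ _ _).
Qed.
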